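(* Let $M$ be a non-minimal meridian surface of type $\mathcal{M}'_b$, i.e. $z(u,v)=f(u)\,l(v)+g(u)\,e_4$ with $l$ a timelike unit-speed curve on $\mathbb{S}^2_1(1)\subset\mathrm{span}\{e_1,e_2,e_3\}$ (respectively, of type $\widetilde{\mathcal{M}}''_a$, i.e. $z(u,v)=g(u)\,e_1+f(u)\,l(v)$ with $l$ a spacelike unit-speed curve on $\mathbb{H}^2_1(-1)\subset\mathrm{span}\{e_2,e_3,e_4\}$), where $f'^2-g'^2=1$ and $g'$ is nowhere zero. Then $M$ has parallel mean curvature vector field if and only if the curve $l$ has zero spherical curvature ($\kappa\equiv0$) and the meridian is determined by $f'=\varphi(f)$, where $$\varphi(t)=\pm\frac{1}{t}\sqrt{(c\pm a\,t^2)^2+t^2},\qquad a=\mathrm{const}\neq0,\quad c=\mathrm{const},$$ and $g$ is determined, up to replacing $g$ by $-g$, by $g'=\sqrt{f'^2-1}$. Moreover, in this case $M$ lies in a hyperplane of $\mathbb{E}^4_2$.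
   Context: Ambient space: $\mathbb{E}^4_2$ is $\mathbb{R}^4$ with the metric $\langle\cdot,\cdot\rangle=dx_1^2+dx_2^2-dx_3^2-dx_4^2$; $e_1,e_2,e_3,e_4$ is the standard basis, so $\langle e_1,e_1\rangle=\langle e_2,e_2\rangle=1$, $\langle e_3,e_3\rangle=\langle e_4,e_4\rangle=-1$. A vector $v$ is spacelike if $\langle v,v\rangle>0$ or $v=0$, timelike if $\langle v,v\rangle<0$. Meridian surfaces: $f,g$ are smooth real functions on an open interval $I$, $f$ nowhere zero; $l$ is a smooth curve on an open interval $J$; $u\in I$, $v\in J$. The curve $u\mapsto(f(u),g(u))$ is called the meridian. The standing assumption that $g'$ is nowhere zero is equivalent here to $f'^2>1$. Type $\mathcal{M}'_b$: $z(u,v)=f(u)l(v)+g(u)e_4$, where $l(v)=\cosh w^1\cos w^2\,e_1+\cosh w^1\sin w^2\,e_2+\sinh w^1\,e_3$ with $w^1=w^1(v)$, $w^2=w^2(v)$ smooth, a curve on $\mathbb{S}^2_1(1)=\{V\in\mathrm{span}\{e_1,e_2,e_3\}:\langle V,V\rangle=1\}$ with $\langle l',l'\rangle=-1$, and $f'^2-g'^2=1$. The first fundamental form is $E=1$, $F=0$, $G=-f^2$. Type $\widetilde{\mathcal{M}}''_a$: $z(u,v)=g(u)e_1+f(u)l(v)$, where $l(v)=\sinh w^1\,e_2+\cosh w^1\cos w^2\,e_3+\cosh w^1\sin w^2\,e_4$ with $w^1,w^2$ smooth functions of $v$, a curve on $\mathbb{H}^2_1(-1)=\{V\in\mathrm{span}\{e_2,e_3,e_4\}:\langle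 V,V\rangle=-1\}$ with $\langle l',l'\rangle=1$, and $f'^2-g'^2=1$. The first fundamental form is $E=-1$, $F=0$, $G=f^2$. (This surface is the image of a surface of type $\mathcal{M}'_b$ under the linear map $T(x_1,x_2,x_3,x_4)=(x_4,x_3,x_1,x_2)$, which reverses the sign of the metric.) Both are Lorentz surfaces (induced metric of signature $(1,1)$). Spherical curvature: let $t=l'$ and let $n(v)$ be the smooth vector field, unique up to sign, in the 3-dimensional space containing $l$, such that $\{l,t,n\}$ is an orthonormal frame (so $\langle n,n\rangle=\pm1$). Then $\kappa(v)=\langle t'(v),n(v)\rangle$ (its overall sign depends on the choice of $n$ and is immaterial here). Mean curvature: $h$ is the second fundamental form, $H=\tfrac12\,\mathrm{tr}\,h$ (trace with respect to the induced metric) is the mean curvature vector field, $D$ is the normal connection. The surface is minimal if $H\equiv0$; it has parallel mean curvature vector field if $DH=0$ identically. Convention on signs: the signs in $\varphi$ are fixed on $I$. *)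

(* Defs.v *)
From Stdlib Require Import Reals.
From Coquelicot Require Import Coquelicot.
Open Scope R_scope.

Definition is_open_interval (D : R -> Prop) : Prop :=
  exists a b : Rbar, Rbar_lt a b /\
    forall x : R, D x <-> Rbar_lt a x /\ Rbar_lt x b.

Definition smooth_on (D : R -> Prop) (f : R -> R) : Prop :=
  forall (k : nat) (x : R), D x -> ex_derive_n f k x.

Definition is_sign (s : R) : Prop := s = 1 \/ s = -1.

(* The vector operations [plus], [minus], [scal], [zero] are Coquelicot's
   canonical ones on the product. *)
Definition vec4 : Type := (R * R * R * R)%type.

Definition x1 (p : vec4) : R := fst (fst (fst p)).
Definition x2 (p : vec4) : R := snd (fst (fst p)).
Definition x3 (p : vec4) : R := snd (fst p).
Definition x4 (p : vec4) : R := snd p.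

Definition e1 : vec4 := (1, 0, 0, 0).
Definition e2 : vec4 := (0, 1, 0, 0).
Definition e3 : vec4 := (0, 0, 1, 0).
Definition e4 : vec4 := (0, 0, 0, 1).

Definition inner (p q : vec4) : R :=
  x1 p * x1 q + x2 p * x2 q - x3 p * x3 q - x4 p * x4 q.

Definition vDerive (c : R -> vec4) (t : R) : vec4 :=
  (Derive (fun s => x1 (c s)) t, Derive (fun s => x2 (c s)) t,
   Derive (fun s => x3 (c s)) t, Derive (fun s => x4 (c s)) t).

Definition vsmooth_on (D : R -> Prop) (c : R -> vec4) : Prop :=
  smooth_on D (fun s => x1 (c s)) /\ smooth_on D (fun s => x2 (c s)) /\
  smooth_on D (fun s => x3 (c s)) /\ smooth_on D (fun s => x4 (c s)).

Definition d_u (z : R -> R -> vec4) (u v : R) : vec4 :=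
  vDerive (fun s => z s v) u.
Definition d_v (z : R -> R -> vec4) (u v : R) : vec4 :=
  vDerive (fun s => z u s) v.

Definition fffE (z : R -> R -> vec4) (u v : R) : R :=
  inner (d_u z u v) (d_u z u v).
Definition fffF (z : R -> R -> vec4) (u v : R) : R :=
  inner (d_u z u v) (d_v z u v).
Definition fffG (z : R -> R -> vec4) (u v : R) : R :=
  inner (d_v z u v) (d_v z u v).
Definition fffW (z : R -> R -> vec4) (u v : R) : R :=
  fffE z u v * fffG z u v - fffF z u v ^ 2.

(* Orthogonal projection onto the tangent plane span{z_u, z_v}: the
   coefficients solve the 2x2 Gram system.  Meaningful when the induced
   metric is nondegenerate, i.e. [fffW z u v <> 0]. *)
Definition tangent_part (z : R -> R -> vec4) (u v : R) (x : vec4) : vec4 :=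
  let xu := inner x (d_u z u v) in
  let xv := inner x (d_v z u v) in
  plus
    (scal ((fffG z u v * xu - fffF z u v * xv) / fffW z u v) (d_u z u v))
    (scal ((fffE z u v * xv - fffF z u v * xu) / fffW z u v) (d_v z u v)).

Definition normal_part (z : R -> R -> vec4) (u v : R) (x : vec4) : vec4 :=
  minus x (tangent_part z u v x).

(* Gauss formula: the values h(z_u,z_u), h(z_u,z_v), h(z_v,z_v) are the normal
   parts of the second partial derivatives. *)
Definition h_uu (z : R -> R -> vec4) (u v : R) : vec4 :=
  normal_part z u v (d_u (d_u z) u v).
Definition h_uv (z : R -> R -> vec4) (u v : R) : vec4 :=
  normal_part z u v (d_u (d_v z) u v).
Definition h_vv (z : R -> R -> vec4) (u v : R) : vec4 :=
  normal_part z u v (d_v (d_v z) u v).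

(* H = (1/2) tr h, i.e. (1/2) g^{ij} h_{ij} with g^{ij} the inverse of the
   matrix of the first fundamental form. *)
Definition mean_curvature (z : R -> R -> vec4) (u v : R) : vec4 :=
  scal (1 / 2)
    (plus (scal (fffG z u v / fffW z u v) (h_uu z u v))
    (plus (scal (- 2 * fffF z u v / fffW z u v) (h_uv z u v))
          (scal (fffE z u v / fffW z u v) (h_vv z u v)))).

(* Normal connection (Weingarten formula) of a normal field [xi]. *)
Definition nabla_perp_u (z xi : R -> R -> vec4) (u v : R) : vec4 :=
  normal_part z u v (d_u xi u v).
Definition nabla_perp_v (z xi : R -> R -> vec4) (u v : R) : vec4 :=
  normal_part z u v (d_v xi u v).

Definition minimal (I J : R -> Prop) (z : R -> R -> vec4) : Prop :=
  forall u v : R, I u -> J v -> mean_curvature z u v = zero.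

Definition parallel_mean_curvature
    (I J : R -> Prop) (z : R -> R -> vec4) : Prop :=
  forall u v : R, I u -> J v ->
    nabla_perp_u z (mean_curvature z) u v = zero /\
    nabla_perp_v z (mean_curvature z) u v = zero.

(* As [inner] is nondegenerate, every affine hyperplane is of the form
   {p | inner m p = d} with m <> 0. *)
Definition lies_in_hyperplane
    (I J : R -> Prop) (z : R -> R -> vec4) : Prop :=
  exists (m : vec4) (d : R), m <> zero /\
    forall u v : R, I u -> J v -> inner m (z u v) = d.

(* [Mb] is the type M'_b, [Ma] is the type \tilde M''_a. *)
Inductive mtype : Type := Mb | Ma.

Definition lcurve (T : mtype) (w1 w2 : R -> R) (v : R) : vec4 :=
  match T with
  | Mb => plus (scal (cosh (w1 v) * cos (w2 v)) e1)
         (plus (scal (cosh (w1 v) * sin (w2 v)) e2)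
               (scal (sinh (w1 v)) e3))
  | Ma => plus (scal (sinh (w1 v)) e2)
         (plus (scal (cosh (w1 v) * cos (w2 v)) e3)
               (scal (cosh (w1 v) * sin (w2 v)) e4))
  end.

Definition lspeed (T : mtype) : R := match T with Mb => -1 | Ma => 1 end.

(* The 3-space containing l: span{e1,e2,e3}, resp. span{e2,e3,e4}. *)
Definition in_lspace (T : mtype) (p : vec4) : Prop :=
  match T with Mb => x4 p = 0 | Ma => x1 p = 0 end.

Definition meridian_map
    (T : mtype) (f g w1 w2 : R -> R) (u v : R) : vec4 :=
  match T with
  | Mb => plus (scal (f u) (lcurve Mb w1 w2 v)) (scal (g u) e4)
  | Ma => plus (scal (g u) e1) (scal (f u) (lcurve Ma w1 w2 v))
  end.

Record meridian_surface
    (T : mtype) (I J : R -> Prop) (f g w1 w2 : R -> R) : Prop := {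
  ms_I : is_open_interval I;
  ms_J : is_open_interval J;
  ms_f_smooth : smooth_on I f;
  ms_g_smooth : smooth_on I g;
  ms_w1_smooth : smooth_on J w1;
  ms_w2_smooth : smooth_on J w2;
  ms_f_neq0 : forall u, I u -> f u <> 0;
  ms_l_speed : forall v, J v ->
    inner (vDerive (lcurve T w1 w2) v) (vDerive (lcurve T w1 w2) v) = lspeed T;
  ms_meridian : forall u, I u -> Derive f u ^ 2 - Derive g u ^ 2 = 1
}.

(* [n] is a smooth field in the 3-space of l making {l, l', n} an orthonormal
   frame.  It exists and is unique up to sign. *)
Definition spherical_normal
    (T : mtype) (J : R -> Prop) (l n : R -> vec4) : Prop :=
  vsmooth_on J n /\
  forall v, J v ->
    in_lspace T (n v) /\
    inner (l v) (n v) = 0 /\ inner (vDerive l v) (n v) = 0 /\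
    (inner (n v) (n v) = 1 \/ inner (n v) (n v) = -1).

Definition spherical_curvature (l n : R -> vec4) (v : R) : R :=
  inner (vDerive (vDerive l) v) (n v).

Definition phi (s1 s2 a c t : R) : R :=
  s1 * (1 / t) * sqrt ((c + s2 * (a * t ^ 2)) ^ 2 + t ^ 2).

(* g' = sqrt (f'^2 - 1) on I, up to replacing g by -g. *)
Definition g_determined (I : R -> Prop) (f g : R -> R) : Prop :=
  (forall u, I u -> Derive g u = sqrt (Derive f u ^ 2 - 1)) \/
  (forall u, I u -> Derive (fun s => - g s) u = sqrt (Derive f u ^ 2 - 1)).

(* Main.v *)
Require Import Defs.
From Stdlib Require Import Reals Ranalysis5 Lra Classical FunctionalExtensionality.
From Coquelicot Require Import Coquelicot.
Open Scope R_scope.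

(** Both types are treated at once.  Write the surface as [z = f l + g e] with [e]
    the axis and put [eps = 1] for the first type and [eps = -1] for the second;
    then [l], [l'], [n], [e] is an orthogonal frame with norms [eps], [-eps], [eps],
    [-eps], and the argument rests on these relations alone.

    With [k] the spherical curvature, the frame satisfies [l'' = l + eps k n].  The
    fields [n] and [N = g' l + f' e] span the normal planes, and computing the
    second fundamental form gives
      [H = (eps / 2) (A N - (eps k / f) n)],  [A = f'' / g' + g' / f]
    ([mean_curvature_eq]).  Since [N_u] is tangent, the part of [D_u H] along [N] is
    a multiple of [A'] and the part along [n] is a multiple of [k f' / f^2]; as
    [f'^2 = 1 + g'^2 > 0], parallelism forces [k = 0] and [A] constant.  Conversely,
    if [k = 0] then [H = (eps / 2) A N], whose derivative in [v] is tangent.  So [H]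
    is parallel exactly when [k = 0] and [A' = 0] ([parallel_iff]).

    The condition on the meridian is integrated by [(f g')' = f f' A]
    ([fg'_diff]).  If [A = 2 a] is constant this gives [f g' = c + a f^2], and
    [f'^2 = 1 + g'^2] becomes [(f f')^2 = (c + a f^2)^2 + f^2], which is the equation
    [f' = phi f] because [f f'] keeps a constant sign ([meridian_ode]); [a] is
    nonzero since [k = 0] and [A = 0] would make the surface minimal.  Conversely the
    equation [f' = phi f] gives [(f g')^2 = (c +- a f^2)^2]; [f g'] never vanishes,
    so [f g' = +- (c +- a f^2)] with a constant sign, and differentiating shows that
    [A] is constant ([trace_coef_const_of_ode]).

    Finally, when [k = 0] the derivative of [n] is orthogonal to the whole frame, so
    [n] is a constant vector, and [z] lies in the hyperplane orthogonal to it. *)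

(** * The scalar product of signature (2,2) *)

Lemma inner_sym (p q : vec4) : inner p q = inner q p.
Proof. unfold inner; ring. Qed.

Lemma inner_plus_l (p q w : vec4) : inner (plus p q) w = inner p w + inner q w.
Proof.
  destruct p as [[[? ?] ?] ?], q as [[[? ?] ?] ?].
  unfold inner; cbn; unfold plus; cbn; ring.
Qed.

Lemma inner_scal_l (a : R) (p w : vec4) : inner (scal a p) w = a * inner p w.
Proof.
  destruct p as [[[? ?] ?] ?].
  unfold inner; cbn; unfold scal; cbn; unfold mult; cbn; ring.
Qed.

Lemma inner_zero_l (w : vec4) : inner zero w = 0.
Proof. unfold inner; cbn; unfold zero; cbn; ring. Qed.

Lemma inner_minus_l (p q w : vec4) : inner (minus p q) w = inner p w - inner q w.
Proof.
  destruct p as [[[? ?] ?] ?], q as [[[? ?] ?] ?].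
  unfold inner; cbn; unfold minus, plus, opp; cbn; ring.
Qed.

Lemma inner_plus_r (w p q : vec4) : inner w (plus p q) = inner w p + inner w q.
Proof. rewrite !(inner_sym w); apply inner_plus_l. Qed.

Lemma inner_scal_r (a : R) (w p : vec4) : inner w (scal a p) = a * inner w p.
Proof. rewrite !(inner_sym w); apply inner_scal_l. Qed.

Lemma inner_minus_r (w p q : vec4) : inner w (minus p q) = inner w p - inner w q.
Proof. rewrite !(inner_sym w); apply inner_minus_l. Qed.

Ltac expand_inner :=
  repeat first [rewrite inner_plus_l | rewrite inner_plus_r
    | rewrite inner_minus_l | rewrite inner_minus_r
    | rewrite inner_scal_l | rewrite inner_scal_r | rewrite inner_zero_l].

(** Nondegeneracy of the scalar product.  Vector identities are proved below by
    pairing both sides with an arbitrary vector. *)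
Lemma inner_ext (p q : vec4) : (forall w, inner p w = inner q w) -> p = q.
Proof.
  intros H.
  pose proof (H e1) as H1; pose proof (H e2) as H2.
  pose proof (H e3) as H3; pose proof (H e4) as H4.
  destruct p as [[[p1 p2] p3] p4], q as [[[q1 q2] q3] q4].
  unfold inner in *; cbn in *.
  f_equal; [f_equal; [f_equal |] |]; lra.
Qed.

Ltac vec_ring := apply inner_ext; intro; expand_inner; ring.

(** * Orthogonal frames *)

(** The determinant with rows [a], [b], [c], [d], by Laplace expansion along the
    first two rows. *)
Definition det4 (a b c d : vec4) : R :=
  (x1 a * x2 b - x2 a * x1 b) * (x3 c * x4 d - x4 c * x3 d)
  - (x1 a * x3 b - x3 a * x1 b) * (x2 c * x4 d - x4 c * x2 d)
  + (x1 a * x4 b - x4 a * x1 b) * (x2 c * x3 d - x3 c * x2 d)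
  + (x2 a * x3 b - x3 a * x2 b) * (x1 c * x4 d - x4 c * x1 d)
  - (x2 a * x4 b - x4 a * x2 b) * (x1 c * x3 d - x3 c * x1 d)
  + (x3 a * x4 b - x4 a * x3 b) * (x1 c * x2 d - x2 c * x1 d).

(** The matrix of the scalar product has determinant [1] (two minus signs), so it
    does not show in the product formula. *)
Lemma det4_mul_gram (a b c d p q r s : vec4) :
  det4 a b c d * det4 p q r s =
  det4 (inner a p, inner a q, inner a r, inner a s)
       (inner b p, inner b q, inner b r, inner b s)
       (inner c p, inner c q, inner c r, inner c s)
       (inner d p, inner d q, inner d r, inner d s).
Proof.
  destruct a as [[[? ?] ?] ?], b as [[[? ?] ?] ?],
   c as [[[? ?] ?] ?], d as [[[? ?] ?] ?],
   p as [[[? ?] ?] ?], q as [[[? ?] ?] ?],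
   r as [[[? ?] ?] ?], s as [[[? ?] ?] ?].
  unfold det4, inner; cbn; ring.
Qed.

(** Cramer's rule for [w = sum_i (coefficient) v_i], paired with [p] so that no
    division occurs. *)
Lemma cramer (a b c d p w : vec4) :
  inner p w * det4 a b c d =
  inner p a * det4 w b c d + inner p b * det4 a w c d +
  inner p c * det4 a b w d + inner p d * det4 a b c w.
Proof.
  destruct a as [[[? ?] ?] ?], b as [[[? ?] ?] ?],
   c as [[[? ?] ?] ?], d as [[[? ?] ?] ?],
   p as [[[? ?] ?] ?], w as [[[? ?] ?] ?].
  unfold det4, inner; cbn; ring.
Qed.

Definition orthogonal4 (a b c d : vec4) : Prop :=
  inner a b = 0 /\ inner a c = 0 /\ inner a d = 0 /\
  inner b c = 0 /\ inner b d = 0 /\ inner c d = 0.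

(** The Gram matrix is diagonal.  This also bounds the signs of the norms: their
    product is a square. *)
Lemma orthogonal4_det (a b c d : vec4) :
  orthogonal4 a b c d ->
  det4 a b c d ^ 2 = inner a a * inner b b * inner c c * inner d d.
Proof.
  intros (ab & ac & ad & bc & bd & cd).
  replace (det4 a b c d ^ 2) with (det4 a b c d * det4 a b c d) by ring.
  rewrite det4_mul_gram.
  rewrite (inner_sym b a), (inner_sym c a), (inner_sym d a),
    (inner_sym c b), (inner_sym d b), (inner_sym d c).
  rewrite ab, ac, ad, bc, bd, cd; unfold det4; cbn; ring.
Qed.

Lemma orthogonal4_complete (a b c d p : vec4) :
  orthogonal4 a b c d ->
  inner a a * inner b b * inner c c * inner d d <> 0 ->
  inner p a = 0 -> inner p b = 0 -> inner p c = 0 -> inner p d = 0 ->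
  p = zero.
Proof.
  intros Ho Hne pa pb pc pd.
  rewrite <- (orthogonal4_det _ _ _ _ Ho) in Hne.
  assert (Hd : det4 a b c d <> 0) by (intros E; apply Hne; rewrite E; ring).
  apply inner_ext; intros w; rewrite inner_zero_l.
  apply (Rmult_eq_reg_r (det4 a b c d)); [| exact Hd].
  rewrite cramer, pa, pb, pc, pd; ring.
Qed.

(** * Derivatives of curves *)

(** Differentiability tested against every linear functional: this makes the
    rules of calculus immediate consequences of the scalar ones. *)
Definition is_vderive (c : R -> vec4) (t : R) (d : vec4) : Prop :=
  forall w, is_derive (fun s => inner (c s) w) t (inner d w).

Lemma is_derive_dot (a1 a2 a3 a4 b1 b2 b3 b4 : R -> R) (t : R) (da db : vec4) :
  is_derive a1 t (x1 da) -> is_derive a2 t (x2 da) ->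
  is_derive a3 t (x3 da) -> is_derive a4 t (x4 da) ->
  is_derive b1 t (x1 db) -> is_derive b2 t (x2 db) ->
  is_derive b3 t (x3 db) -> is_derive b4 t (x4 db) ->
  is_derive (fun s => inner (a1 s, a2 s, a3 s, a4 s) (b1 s, b2 s, b3 s, b4 s)) t
    (inner da (b1 t, b2 t, b3 t, b4 t) + inner (a1 t, a2 t, a3 t, a4 t) db).
Proof.
  intros A1 A2 A3 A4 B1 B2 B3 B4.
  assert (M : forall a b p q, is_derive a t p -> is_derive b t q ->
            is_derive (fun s => a s * b s) t (p * b t + a t * q)).
  { intros a b p q Ha Hb; apply (is_derive_mult a b t p q Ha Hb Rmult_comm). }
  evar_last.
  - apply (is_derive_minus (fun s => a1 s * b1 s + a2 s * b2 s - a3 s * b3 s)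
             (fun s => a4 s * b4 s)); [| apply (M _ _ _ _ A4 B4)].
    apply (is_derive_minus (fun s => a1 s * b1 s + a2 s * b2 s)
             (fun s => a3 s * b3 s)); [| apply (M _ _ _ _ A3 B3)].
    apply (is_derive_plus (fun s => a1 s * b1 s) (fun s => a2 s * b2 s));
      [apply (M _ _ _ _ A1 B1) | apply (M _ _ _ _ A2 B2)].
  - unfold inner, minus, plus, opp; cbn; ring.
Qed.

Lemma is_vderive_coord (c : R -> vec4) (t : R) (d : vec4) :
  is_vderive c t d <->
  is_derive (fun s => x1 (c s)) t (x1 d) /\ is_derive (fun s => x2 (c s)) t (x2 d) /\
  is_derive (fun s => x3 (c s)) t (x3 d) /\ is_derive (fun s => x4 (c s)) t (x4 d).
Proof.
  split.
  - intros H.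
    assert (K : forall (x : vec4 -> R) w, (forall p, inner p w = x p) ->
              is_derive (fun s => x (c s)) t (x d)).
    { intros x w E. rewrite <- E.
      apply (is_derive_ext (fun s => inner (c s) w)); [intro; apply E | apply H]. }
    (* The last two coordinates are the products with [- e3] and [- e4]. *)
    split; [| split; [| split]];
      [apply (K x1 e1) | apply (K x2 e2)
       | apply (K x3 (scal (-1) e3)) | apply (K x4 (scal (-1) e4))];
      intros p; unfold inner; cbn; unfold scal; cbn; unfold mult; cbn; ring.
  - intros (H1 & H2 & H3 & H4) w.
    replace (inner d w) with (inner d w + inner (c t) zero)
      by (rewrite (inner_sym (c t)), inner_zero_l; ring).
    apply (is_derive_dot (fun s => x1 (c s)) (fun s => x2 (c s))
             (fun s => x3 (c s)) (fun s => x4 (c s))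
             (fun _ => x1 w) (fun _ => x2 w) (fun _ => x3 w) (fun _ => x4 w));
      try assumption; apply @is_derive_const.
Qed.

Lemma vDerive_unique (c : R -> vec4) (t : R) (d : vec4) :
  is_vderive c t d -> vDerive c t = d.
Proof.
  intros (H1 & H2 & H3 & H4)%is_vderive_coord.
  apply is_derive_unique in H1, H2, H3, H4.
  destruct d as [[[? ?] ?] ?]; unfold vDerive.
  f_equal; [f_equal; [f_equal |] |]; assumption.
Qed.

Lemma is_vderive_vDerive (c : R -> vec4) (t : R) :
  ex_derive (fun s => x1 (c s)) t -> ex_derive (fun s => x2 (c s)) t ->
  ex_derive (fun s => x3 (c s)) t -> ex_derive (fun s => x4 (c s)) t ->
  is_vderive c t (vDerive c t).
Proof.
  intros; apply is_vderive_coord; cbn.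
  repeat split; apply Derive_correct; assumption.
Qed.

Lemma is_vderive_ext_loc (c b : R -> vec4) (t : R) (d : vec4) :
  locally t (fun s => c s = b s) -> is_vderive c t d -> is_vderive b t d.
Proof.
  intros He Hc w.
  apply (is_derive_ext_loc (fun s => inner (c s) w)); [| apply Hc].
  apply (filter_imp _ _ (fun s E => f_equal (fun p => inner p w) E) He).
Qed.

Lemma is_vderive_const (p : vec4) (t : R) : is_vderive (fun _ => p) t zero.
Proof. intros w; rewrite inner_zero_l; apply (is_derive_const (inner p w) t). Qed.

Lemma is_vderive_plus (c b : R -> vec4) (t : R) (dc db : vec4) :
  is_vderive c t dc -> is_vderive b t db ->
  is_vderive (fun s => plus (c s) (b s)) t (plus dc db).
Proof.
  intros Hc Hb w; rewrite inner_plus_l.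
  apply (is_derive_ext (fun s => inner (c s) w + inner (b s) w)).
  - intros s; symmetry; apply inner_plus_l.
  - apply (is_derive_plus (fun s => inner (c s) w) (fun s => inner (b s) w));
      [apply Hc | apply Hb].
Qed.

Lemma is_vderive_scal (h : R -> R) (c : R -> vec4) (t dh : R) (dc : vec4) :
  is_derive h t dh -> is_vderive c t dc ->
  is_vderive (fun s => scal (h s) (c s)) t (plus (scal dh (c t)) (scal (h t) dc)).
Proof.
  intros Hh Hc w; rewrite inner_plus_l, !inner_scal_l.
  apply (is_derive_ext (fun s => h s * inner (c s) w)).
  - intros s; symmetry; apply inner_scal_l.
  - apply (is_derive_mult h (fun s => inner (c s) w)); [exact Hh | apply Hc |].
    intros; apply Rmult_comm.
Qed.

Lemma is_derive_inner (c b : R -> vec4) (t : R) (dc db : vec4) :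
  is_vderive c t dc -> is_vderive b t db ->
  is_derive (fun s => inner (c s) (b s)) t (inner dc (b t) + inner (c t) db).
Proof.
  intros (C1 & C2 & C3 & C4)%is_vderive_coord (B1 & B2 & B3 & B4)%is_vderive_coord.
  apply (is_derive_dot (fun s => x1 (c s)) (fun s => x2 (c s))
           (fun s => x3 (c s)) (fun s => x4 (c s))
           (fun s => x1 (b s)) (fun s => x2 (b s))
           (fun s => x3 (b s)) (fun s => x4 (b s))); assumption.
Qed.

(** * Functions on an open interval *)

Lemma open_interval_locally (D : R -> Prop) (x : R) :
  is_open_interval D -> D x -> locally x D.
Proof.
  intros (a & b & _ & HD) Hx.
  apply HD in Hx; destruct Hx as [Ha Hb].
  apply (locally_interval _ x a b Ha Hb).
  intros y Hy1 Hy2; apply HD; split; assumption.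
Qed.

Lemma open_interval_convex (D : R -> Prop) (x y z : R) :
  is_open_interval D -> D x -> D y -> x <= z <= y -> D z.
Proof.
  intros (a & b & _ & HD) Hx Hy [xz zy].
  apply HD in Hx; apply HD in Hy; apply HD.
  destruct Hx as [ax _], Hy as [_ yb]; split.
  - apply (Rbar_lt_le_trans a x z); [exact ax | exact xz].
  - apply (Rbar_le_lt_trans z y b); [exact zy | exact yb].
Qed.

(** Differentiating a relation that holds on an open interval. *)
Lemma derive_locally_const (D : R -> Prop) (h : R -> R) (k x d : R) :
  is_open_interval D -> (forall y, D y -> h y = k) -> D x ->
  is_derive h x d -> d = 0.
Proof.
  intros HD Hk Hx Hd.
  rewrite <- (is_derive_unique _ _ _ Hd).
  rewrite (Derive_ext_loc h (fun _ => k)).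
  - apply Derive_const.
  - apply (filter_imp D); [exact Hk | apply open_interval_locally; assumption].
Qed.

Lemma derive_zero_const (D : R -> Prop) (h : R -> R) (x y : R) :
  is_open_interval D -> (forall z, D z -> is_derive h z 0) ->
  D x -> D y -> h x = h y.
Proof.
  intros HD Hh.
  assert (K : forall p q, p < q -> D p -> D q -> h p = h q).
  { intros p q pq Dp Dq; apply (eq_is_derive h p q); [| exact pq].
    intros t Ht; apply Hh; apply (open_interval_convex D p q t HD Dp Dq Ht). }
  intros Dx Dy; destruct (Rtotal_order x y) as [xy | [xy | xy]].
  - apply K; assumption.
  - rewrite xy; reflexivity.
  - symmetry; apply K; assumption.
Qed.

(** The sign choices in the theorem are uniform over the interval for this reason. *)
Lemma nonzero_constant_sign (D : R -> Prop) (h : R -> R) :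
  is_open_interval D -> (forall z, D z -> ex_derive h z) ->
  (forall z, D z -> h z <> 0) ->
  exists s, is_sign s /\ forall z, D z -> 0 < s * h z.
Proof.
  intros HD Hh Hz.
  assert (Hc : forall z, D z -> continuity_pt h z).
  { intros z Dz; apply derivable_continuous_pt, ex_derive_Reals_0, Hh, Dz. }
  destruct (classic (exists z, D z /\ h z < 0)) as [(x & Dx & hx) | Hn].
  - exists (-1); split; [right; reflexivity |].
    intros y Dy.
    destruct (Rtotal_order (h y) 0) as [hy | [hy | hy]]; [lra | destruct (Hz y Dy hy) |].
    exfalso.
    destruct (Rtotal_order x y) as [xy | [xy | xy]].
    + destruct (IVT_interv h x y) as (z & Hxz & E); try assumption.
      * intros a Ha; apply Hc, (open_interval_convex D x y a HD Dx Dy Ha).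
      * apply (Hz z (open_interval_convex D x y z HD Dx Dy Hxz) E).
    + subst; lra.
    + destruct (IVT_interv (fun s => - h s) y x) as (z & Hxz & E); try lra.
      * intros a Ha; apply (continuity_pt_opp h).
        apply Hc, (open_interval_convex D y x a HD Dy Dx Ha).
      * apply (Hz z (open_interval_convex D y x z HD Dy Dx Hxz)); lra.
  - exists 1; split; [left; reflexivity |].
    intros y Dy.
    destruct (Rtotal_order (h y) 0) as [hy | [hy | hy]]; [| destruct (Hz y Dy hy) | lra].
    exfalso; apply Hn; exists y; split; assumption.
Qed.

Lemma sqrt_of_sq (s x y : R) : is_sign s -> 0 <= s * x -> x ^ 2 = y -> sqrt y = s * x.
Proof.
  intros [-> | ->] H <-.
  - rewrite Rmult_1_l in *; apply sqrt_pow2; exact H.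
  - replace (x ^ 2) with ((-1 * x) ^ 2) by ring; apply sqrt_pow2; exact H.
Qed.

Lemma sq_eq_sign (s x y : R) : is_sign s -> x ^ 2 = y ^ 2 -> 0 < s * (x * y) -> x = s * y.
Proof.
  intros Hs E H.
  assert (E' : (x - y) * (x + y) = 0) by lra.
  apply Rmult_integral in E'.
  pose proof (pow2_ge_0 y).
  destruct E' as [E' | E'];
    [replace x with y in * by lra | replace x with (- y) in * by lra];
    destruct Hs as [-> | ->]; lra.
Qed.

(** * The geometry of a meridian surface *)

(** What both types have in common; [n] plays the role of the spherical normal of
    [l], and [eps] is the sign of [<l, l>]. *)
Record meridian_frame (I J : R -> Prop) (f g : R -> R) (l n : R -> vec4)
    (e : vec4) (eps : R) : Prop := {
  mf_eps : is_sign eps;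
  mf_I : is_open_interval I;
  mf_J : is_open_interval J;
  mf_f : smooth_on I f;
  mf_g : smooth_on I g;
  mf_f0 : forall u, I u -> f u <> 0;
  mf_g0 : forall u, I u -> Derive g u <> 0;
  mf_unit : forall u, I u -> Derive f u ^ 2 - Derive g u ^ 2 = 1;
  mf_l : forall v, J v -> is_vderive l v (vDerive l v);
  mf_t : forall v, J v -> is_vderive (vDerive l) v (vDerive (vDerive l) v);
  mf_n : forall v, J v -> is_vderive n v (vDerive n v);
  mf_ll : forall v, J v -> inner (l v) (l v) = eps;
  mf_tt : forall v, J v -> inner (vDerive l v) (vDerive l v) = - eps;
  mf_nn : forall v, J v -> inner (n v) (n v) = 1 \/ inner (n v) (n v) = -1;
  mf_ln : forall v, J v -> inner (l v) (n v) = 0;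
  mf_tn : forall v, J v -> inner (vDerive l v) (n v) = 0;
  mf_ee : inner e e = - eps;
  mf_le : forall v, J v -> inner (l v) e = 0;
  mf_ne : forall v, J v -> inner (n v) e = 0
}.

Arguments mf_eps {I J f g l n e eps}.
Arguments mf_I {I J f g l n e eps}.
Arguments mf_J {I J f g l n e eps}.
Arguments mf_f {I J f g l n e eps}.
Arguments mf_g {I J f g l n e eps}.
Arguments mf_f0 {I J f g l n e eps}.
Arguments mf_g0 {I J f g l n e eps}.
Arguments mf_unit {I J f g l n e eps}.
Arguments mf_l {I J f g l n e eps}.
Arguments mf_t {I J f g l n e eps}.
Arguments mf_n {I J f g l n e eps}.
Arguments mf_ll {I J f g l n e eps}.
Arguments mf_tt {I J f g l n e eps}.
Arguments mf_nn {I J f g l n e eps}.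
Arguments mf_ln {I J f g l n e eps}.
Arguments mf_tn {I J f g l n e eps}.
Arguments mf_ee {I J f g l n e eps}.
Arguments mf_le {I J f g l n e eps}.
Arguments mf_ne {I J f g l n e eps}.

Definition surf (f g : R -> R) (l : R -> vec4) (e : vec4) (u v : R) : vec4 :=
  plus (scal (f u) (l v)) (scal (g u) e).

(** Twice the coefficient of the mean curvature vector along the normal
    [g' l + f' e], up to sign. *)
Definition trace_coef (f g : R -> R) (u : R) : R :=
  Derive (Derive f) u / Derive g u + Derive g u / f u.

Lemma is_sign_sq (s : R) : is_sign s -> s * s = 1.
Proof. intros [-> | ->]; ring. Qed.

Lemma is_vderive_surf_u (f g : R -> R) (l : R -> vec4) (e : vec4) (u v df dg : R) :
  is_derive f u df -> is_derive g u dg ->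
  is_vderive (fun s => surf f g l e s v) u (plus (scal df (l v)) (scal dg e)).
Proof.
  intros Hf Hg.
  replace (plus (scal df (l v)) (scal dg e)) with
    (plus (plus (scal df (l v)) (scal (f u) zero))
          (plus (scal dg e) (scal (g u) zero))) by vec_ring.
  apply is_vderive_plus;
    [apply (is_vderive_scal f (fun _ => l v)) | apply (is_vderive_scal g (fun _ => e))];
    auto using is_vderive_const.
Qed.

Lemma is_vderive_surf_v (f g : R -> R) (l : R -> vec4) (e : vec4) (u v : R) (dl : vec4) :
  is_vderive l v dl ->
  is_vderive (fun s => surf f g l e u s) v (scal (f u) dl).
Proof.
  intros Hl.
  replace (scal (f u) dl) with
    (plus (plus (scal 0 (l v)) (scal (f u) dl)) zero) by vec_ring.
  apply is_vderive_plus; [| apply is_vderive_const].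
  apply (is_vderive_scal (fun _ => f u) l); [apply @is_derive_const | exact Hl].
Qed.

(** The Gram system is diagonal because the coordinates are orthogonal. *)
Lemma normal_part_split (z : R -> R -> vec4) (u v a b : R) (p : vec4) :
  fffF z u v = 0 -> fffE z u v <> 0 -> fffG z u v <> 0 ->
  inner p (d_u z u v) = 0 -> inner p (d_v z u v) = 0 ->
  normal_part z u v
    (plus (plus (scal a (d_u z u v)) (scal b (d_v z u v))) p) = p.
Proof.
  intros HF HE HG Hu Hv.
  unfold normal_part, tangent_part.
  expand_inner.
  rewrite Hu, Hv, (inner_sym (d_v z u v) (d_u z u v)).
  change (inner (d_u z u v) (d_u z u v)) with (fffE z u v).
  change (inner (d_v z u v) (d_v z u v)) with (fffG z u v).
  change (inner (d_u z u v) (d_v z u v)) with (fffF z u v).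
  unfold fffW; rewrite HF.
  apply inner_ext; intro w; expand_inner; field; auto.
Qed.

Section Geometry.

Context {I J : R -> Prop} {f g : R -> R} {l n : R -> vec4} {e : vec4} {eps : R}.
Context (M : meridian_frame I J f g l n e eps).

Let z := surf f g l e.
Let A := trace_coef f g.
Let t := vDerive l.
Let k := spherical_curvature l n.

Lemma f_diff u : I u -> is_derive f u (Derive f u).
Proof. intros Hu; apply Derive_correct, (mf_f M 1%nat u Hu). Qed.

Lemma f_diff2 u : I u -> is_derive (Derive f) u (Derive (Derive f) u).
Proof. intros Hu; apply Derive_correct, (mf_f M 2%nat u Hu). Qed.

Lemma f_diff3 u : I u -> is_derive (Derive (Derive f)) u (Derive (Derive (Derive f)) u).
Proof. intros Hu; apply Derive_correct, (mf_f M 3%nat u Hu). Qed.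

Lemma g_diff u : I u -> is_derive g u (Derive g u).
Proof. intros Hu; apply Derive_correct, (mf_g M 1%nat u Hu). Qed.

Lemma g_diff2 u : I u -> is_derive (Derive g) u (Derive (Derive g) u).
Proof. intros Hu; apply Derive_correct, (mf_g M 2%nat u Hu). Qed.

Lemma f'_neq0 u : I u -> Derive f u <> 0.
Proof.
  intros Hu E; pose proof (mf_unit M u Hu) as H.
  rewrite E in H; nra.
Qed.

(** Derivative of [f'^2 - g'^2 = 1].  Consequently [(f'', g'')] is the multiple
    [f'' / g'] of [(g', f')], which makes [z_uu] normal. *)
Lemma f'f''_g'g'' u : I u ->
  Derive f u * Derive (Derive f) u = Derive g u * Derive (Derive g) u.
Proof.
  intros Hu.
  assert (H : is_derive (fun s => Derive f s ^ 2 - Derive g s ^ 2) u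
     (2 * (Derive f u * Derive (Derive f) u - Derive g u * Derive (Derive g) u))).
  { evar_last.
    - apply (is_derive_minus (fun s => Derive f s ^ 2) (fun s => Derive g s ^ 2));
        apply is_derive_pow; [apply f_diff2, Hu | apply g_diff2, Hu].
    - unfold minus, plus, opp; cbn; ring. }
  pose proof (derive_locally_const I _ 1 u _ (mf_I M)
    (mf_unit M) Hu H).
  lra.
Qed.

Lemma g''_eq u : I u ->
  Derive (Derive g) u = Derive f u * Derive (Derive f) u / Derive g u.
Proof.
  intros Hu; rewrite (f'f''_g'g'' u Hu); field.
  apply (mf_g0 M u Hu).
Qed.

Lemma trace_coef_diff u : I u -> is_derive A u (Derive A u).
Proof.
  intros Hu; apply Derive_correct.
  unfold A, trace_coef.
  apply (ex_derive_plus (fun s => Derive (Derive f) s / Derive g s)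
           (fun s => Derive g s / f s)).
  - apply (ex_derive_div (Derive (Derive f)) (Derive g)).
    + eexists; apply f_diff3, Hu.
    + eexists; apply g_diff2, Hu.
    + apply (mf_g0 M u Hu).
  - apply (ex_derive_div (Derive g) f).
    + eexists; apply g_diff2, Hu.
    + eexists; apply f_diff, Hu.
    + apply (mf_f0 M u Hu).
Qed.

Lemma inner_l_t v : J v -> inner (l v) (t v) = 0.
Proof.
  intros Hv.
  pose proof (derive_locally_const J _ eps v _ (mf_J M)
    (mf_ll M) Hv
    (is_derive_inner l l v _ _ (mf_l M v Hv) (mf_l M v Hv))) as H.
  rewrite (inner_sym (vDerive l v)) in H; unfold t; lra.
Qed.

Lemma inner_t_e v : J v -> inner (t v) e = 0.
Proof.
  intros Hv.
  pose proof (derive_locally_const J _ 0 v _ (mf_J M)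
    (mf_le M) Hv
    (is_derive_inner l (fun _ => e) v _ _ (mf_l M v Hv)
      (is_vderive_const e v))) as H.
  rewrite (inner_sym (l v)), inner_zero_l in H; unfold t; lra.
Qed.

Lemma frame_orthogonal v : J v -> orthogonal4 (l v) (t v) (n v) e.
Proof.
  intros Hv; repeat split; [apply inner_l_t | apply (mf_ln M) | apply (mf_le M)
    | apply (mf_tn M) | apply inner_t_e | apply (mf_ne M)]; exact Hv.
Qed.

(** The sign of [<n, n>] is determined: in signature (2,2) an orthonormal frame has
    an even number of timelike vectors. *)
Lemma nn_eps v : J v -> inner (n v) (n v) = eps.
Proof.
  intros Hv.
  pose proof (orthogonal4_det _ _ _ _ (frame_orthogonal v Hv)) as H.
  unfold t in H.
  rewrite (mf_ll M v Hv), (mf_tt M v Hv), (mf_ee M) in H.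
  pose proof (pow2_ge_0 (det4 (l v) (vDerive l v) (n v) e)) as H0.
  destruct (mf_eps M) as [E | E], (mf_nn M v Hv) as [E' | E'];
    rewrite E, E' in H; lra.
Qed.

Lemma frame_complete v p : J v ->
  inner p (l v) = 0 -> inner p (t v) = 0 -> inner p (n v) = 0 -> inner p e = 0 ->
  p = zero.
Proof.
  intros Hv; apply orthogonal4_complete.
  - apply frame_orthogonal, Hv.
  - unfold t.
    rewrite (mf_ll M v Hv), (mf_tt M v Hv),
      (nn_eps v Hv), (mf_ee M).
    destruct (mf_eps M) as [-> | ->]; lra.
Qed.

(** The Frenet equation of [l]: the coefficients come from differentiating the
    orthogonality relations, and the frame is complete. *)
Lemma t'_eq v : J v -> vDerive t v = plus (l v) (scal (eps * k v) (n v)).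
Proof.
  intros Hv.
  pose proof (derive_locally_const J _ 0 v _ (mf_J M)
    inner_l_t Hv
    (is_derive_inner l t v _ _ (mf_l M v Hv) (mf_t M v Hv)))
    as Hl.
  pose proof (derive_locally_const J _ (-eps) v _ (mf_J M)
    (mf_tt M) Hv
    (is_derive_inner t t v _ _ (mf_t M v Hv) (mf_t M v Hv)))
    as Ht.
  pose proof (derive_locally_const J _ 0 v _ (mf_J M)
    inner_t_e Hv
    (is_derive_inner t (fun _ => e) v _ _ (mf_t M v Hv)
      (is_vderive_const e v))) as He.
  rewrite (inner_sym (t v)), inner_zero_l in He.
  rewrite (inner_sym (l v)) in Hl.
  rewrite (inner_sym (t v)) in Ht.
  pose proof (is_sign_sq eps (mf_eps M)) as Heps.
  pose proof (inner_l_t v Hv) as Hlt.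
  pose proof (mf_tt M v Hv) as Htt.
  pose proof (mf_ll M v Hv) as Hll.
  pose proof (mf_ln M v Hv) as Hln.
  pose proof (mf_tn M v Hv) as Htn.
  pose proof (nn_eps v Hv) as Hnn.
  pose proof (mf_le M v Hv) as Hle.
  pose proof (mf_ne M v Hv) as Hne.
  unfold k, spherical_curvature; fold t; fold t in Htt, Htn, Hl, Ht, He.
  set (d := vDerive t v) in *.
  assert (H : minus d (plus (l v) (scal (eps * inner d (n v)) (n v))) = zero).
  { apply (frame_complete v _ Hv); expand_inner.
    - rewrite (inner_sym (n v) (l v)), Hln, Hll; lra.
    - rewrite (inner_sym (n v) (t v)), Htn, Hlt; lra.
    - rewrite Hln, Hnn; ring [Heps].
    - rewrite Hle, Hne; lra. }
  apply inner_ext; intro w.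
  apply (f_equal (fun p => inner p w)) in H; revert H; expand_inner; lra.
Qed.

(** Here [<n', l'> = - k = 0], and the other products of [n'] with the frame vanish in
    any case. *)
Lemma n_const : (forall v, J v -> k v = 0) ->
  forall v w, J v -> J w -> n v = n w.
Proof.
  intros Hk.
  assert (H : forall v, J v -> vDerive n v = zero).
  { intros v Hv.
    pose proof (mf_n M v Hv) as Dn.
    pose proof (derive_locally_const J _ 0 v _ (mf_J M)
      (mf_ln M) Hv
      (is_derive_inner l n v _ _ (mf_l M v Hv) Dn)) as Hl.
    pose proof (derive_locally_const J _ 0 v _ (mf_J M)
      (mf_tn M) Hv
      (is_derive_inner t n v _ _ (mf_t M v Hv) Dn)) as Ht.
    pose proof (derive_locally_const J _ eps v _ (mf_J M)
      nn_eps Hv (is_derive_inner n n v _ _ Dn Dn)) as Hn.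
    pose proof (derive_locally_const J _ 0 v _ (mf_J M)
      (mf_ne M) Hv
      (is_derive_inner n (fun _ => e) v _ _ Dn (is_vderive_const e v))) as He.
    rewrite (inner_sym (n v) zero), inner_zero_l in He.
    rewrite (inner_sym (l v)), (mf_tn M v Hv) in Hl.
    specialize (Hk v Hv); unfold k, spherical_curvature in Hk; fold t in Hk.
    fold t in Ht; rewrite Hk, (inner_sym (t v)) in Ht.
    rewrite (inner_sym (n v)) in Hn.
    apply (frame_complete v _ Hv); lra. }
  intros v w Hv Hw; apply inner_ext; intro x.
  apply (derive_zero_const J (fun s => inner (n s) x) v w); try assumption.
  - apply (mf_J M).
  - intros s Hs; rewrite <- (inner_zero_l x), <- (H s Hs).
    apply (mf_n M s Hs).
Qed.

Lemma lies_in_hyperplane_of_flat : (exists v, J v) ->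
  (forall v, J v -> k v = 0) -> lies_in_hyperplane I J z.
Proof.
  intros [v0 Hv0] Hk; exists (n v0), 0; split.
  - intros E; pose proof (nn_eps v0 Hv0) as H.
    rewrite E, inner_zero_l in H.
    destruct (mf_eps M); lra.
  - intros u v Hu Hv; rewrite (n_const Hk v0 v Hv0 Hv).
    unfold z, surf; expand_inner.
    rewrite (inner_sym (n v) (l v)), (mf_ln M v Hv),
      (mf_ne M v Hv); ring.
Qed.

(** Exchanging the two coefficients of [z_u = f' l + g' e] gives an orthogonal vector,
    since [l] and [e] have opposite norms. *)
Definition meridian_normal : R -> R -> vec4 := surf (Derive g) (Derive f) l e.
Let N := meridian_normal.

Lemma z_u u v : I u -> d_u z u v = surf (Derive f) (Derive g) l e u v.
Proof.
  intros Hu; apply vDerive_unique, is_vderive_surf_u; [apply f_diff | apply g_diff]; exact Hu.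
Qed.

Lemma z_v u v : J v -> d_v z u v = scal (f u) (t v).
Proof.
  intros Hv; apply vDerive_unique, is_vderive_surf_v, (mf_l M v Hv).
Qed.

Lemma z_uu u v : I u -> d_u (d_u z) u v = scal (Derive (Derive f) u / Derive g u) (N u v).
Proof.
  intros Hu.
  transitivity (plus (scal (Derive (Derive f) u) (l v)) (scal (Derive (Derive g) u) e)).
  - apply vDerive_unique.
    apply (is_vderive_ext_loc (fun s => surf (Derive f) (Derive g) l e s v)).
    + apply (filter_imp I); [intros s Hs; symmetry; apply z_u, Hs |].
      apply open_interval_locally; [apply (mf_I M) | exact Hu].
    + apply is_vderive_surf_u; [apply f_diff2 | apply g_diff2]; exact Hu.
  - rewrite (g''_eq u Hu); pose proof (mf_g0 M u Hu).
    apply inner_ext; intro w; unfold N, meridian_normal, surf; expand_inner; field; assumption.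
Qed.

Lemma z_vv u v : J v ->
  d_v (d_v z) u v = scal (f u) (plus (l v) (scal (eps * k v) (n v))).
Proof.
  intros Hv; rewrite <- (t'_eq v Hv).
  apply vDerive_unique.
  apply (is_vderive_ext_loc (fun s => scal (f u) (t s))).
  - apply (filter_imp J); [intros s Hs; symmetry; apply z_v, Hs |].
    apply open_interval_locally; [apply (mf_J M) | exact Hv].
  - replace (scal (f u) (vDerive t v)) with
      (plus (scal 0 (t v)) (scal (f u) (vDerive t v))) by vec_ring.
    apply (is_vderive_scal (fun _ => f u) t); [apply @is_derive_const |].
    apply (mf_t M v Hv).
Qed.

Lemma surf_inner (a b c d : R -> R) u v : J v ->
  inner (surf a b l e u v) (surf c d l e u v) = eps * (a u * c u - b u * d u).
Proof.
  intros Hv; unfold surf; expand_inner.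
  rewrite (inner_sym e (l v)), (mf_ll M v Hv),
    (mf_le M v Hv), (mf_ee M); ring.
Qed.

Lemma surf_ortho_t a b u v : J v -> inner (surf a b l e u v) (t v) = 0.
Proof.
  intros Hv; unfold surf; expand_inner.
  rewrite (inner_sym e (t v)), (inner_l_t v Hv), (inner_t_e v Hv); ring.
Qed.

Lemma surf_ortho_n a b u v : J v -> inner (surf a b l e u v) (n v) = 0.
Proof.
  intros Hv; unfold surf; expand_inner.
  rewrite (inner_sym e (n v)), (mf_ln M v Hv), (mf_ne M v Hv);
    ring.
Qed.

Lemma first_fundamental_form u v : I u -> J v ->
  fffE z u v = eps /\ fffF z u v = 0 /\ fffG z u v = - eps * f u ^ 2.
Proof.
  intros Hu Hv; unfold fffE, fffF, fffG.
  rewrite (z_u u v Hu), (z_v u v Hv); expand_inner.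
  rewrite (surf_inner _ _ _ _ u v Hv), (surf_ortho_t _ _ u v Hv).
  unfold t; rewrite (mf_tt M v Hv).
  pose proof (mf_unit M u Hu) as H.
  repeat split; try ring.
  replace (_ - _) with 1 by (rewrite <- H; ring); ring.
Qed.

(** Along the frame [z_u], [l'], [N], [n] the normal part is read off the
    coefficients; every normal projection below is computed this way. *)
Lemma normal_part_eq u v x a b c d : I u -> J v ->
  x = plus (plus (scal a (d_u z u v)) (scal b (t v)))
           (plus (scal c (N u v)) (scal d (n v))) ->
  normal_part z u v x = plus (scal c (N u v)) (scal d (n v)).
Proof.
  intros Hu Hv ->.
  destruct (first_fundamental_form u v Hu Hv) as (HE & HF & HG).
  pose proof (mf_f0 M u Hu) as Hf.
  assert (Heps : eps <> 0) by (destruct (mf_eps M); lra).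
  replace (scal b (t v)) with (scal (b / f u) (d_v z u v)).
  2:{ rewrite (z_v u v Hv); apply inner_ext; intro w; expand_inner; field; exact Hf. }
  apply normal_part_split; try assumption.
  - rewrite HE; exact Heps.
  - rewrite HG; intros E; apply Rmult_integral in E; destruct E as [E | E]; [lra |].
    revert E; apply pow_nonzero, Hf.
  - rewrite (z_u u v Hu); expand_inner.
    rewrite (inner_sym (n v)), (surf_ortho_n _ _ u v Hv).
    unfold N, meridian_normal; rewrite (surf_inner _ _ _ _ u v Hv); ring.
  - rewrite (z_v u v Hv); expand_inner.
    rewrite (inner_sym (n v)); unfold t at 2; rewrite (mf_tn M v Hv).
    unfold N, meridian_normal; rewrite (surf_ortho_t _ _ u v Hv); ring.
Qed.

Lemma mean_curvature_eq u v : I u -> J v ->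
  mean_curvature z u v =
  scal (eps / 2) (plus (scal (A u) (N u v)) (scal (- (eps * k v / f u)) (n v))).
Proof.
  intros Hu Hv.
  pose proof (mf_f0 M u Hu) as Hf.
  pose proof (mf_g0 M u Hu) as Hg.
  assert (Huu : h_uu z u v =
     plus (scal (Derive (Derive f) u / Derive g u) (N u v)) (scal 0 (n v))).
  { apply (normal_part_eq u v _ 0 0); try assumption.
    rewrite (z_uu u v Hu); vec_ring. }
  assert (Hvv : h_vv z u v =
     plus (scal (- f u * Derive g u) (N u v)) (scal (eps * k v * f u) (n v))).
  { (* [f'^2 - g'^2 = 1] gives [l = f' z_u - g' N]. *)
    apply (normal_part_eq u v _ (f u * Derive f u) 0); try assumption.
    rewrite (z_vv u v Hv), (z_u u v Hu).
    pose proof (mf_unit M u Hu) as H.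
    apply inner_ext; intro w; unfold N, meridian_normal, surf; expand_inner.
    assert (H' : Derive f u * Derive f u = 1 + Derive g u * Derive g u) by lra.
    ring [H']. }
  unfold mean_curvature; rewrite Huu, Hvv.
  (* The mixed term drops out because [F = 0]. *)
  destruct (first_fundamental_form u v Hu Hv) as (HE & HF & HG).
  unfold fffW; rewrite HE, HF, HG.
  unfold A, trace_coef.
  apply inner_ext; intro w; expand_inner.
  destruct (mf_eps M) as [-> | ->]; field; auto.
Qed.

(** The term coming from the derivative of [N] is [A (f'' / g') z_u], which is
    tangent. *)
Lemma nabla_u_eq u v : I u -> J v ->
  nabla_perp_u z (mean_curvature z) u v =
  plus (scal (eps / 2 * Derive A u) (N u v))
       (scal (k v * Derive f u / (2 * f u ^ 2)) (n v)).
Proof.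
  intros Hu Hv.
  pose proof (mf_f0 M u Hu) as Hf.
  pose proof (mf_g0 M u Hu) as Hg.
  pose proof (is_sign_sq eps (mf_eps M)) as Heps.
  apply (normal_part_eq u v _
    (eps / 2 * (A u * (Derive (Derive f) u / Derive g u))) 0); try assumption.
  apply vDerive_unique.
  apply (is_vderive_ext_loc (fun s =>
    plus (scal (eps / 2 * A s) (N s v)) (scal (- (k v / 2) * / f s) (n v)))).
  { apply (filter_imp I).
    - intros s Hs; rewrite (mean_curvature_eq s v Hs Hv).
      apply inner_ext; intro w; expand_inner; unfold Rdiv; ring [Heps].
    - apply open_interval_locally; [apply (mf_I M) | exact Hu]. }
  assert (DA : is_derive (fun s => eps / 2 * A s) u (eps / 2 * Derive A u)).
  { apply is_derive_scal, trace_coef_diff, Hu. }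
  assert (Df : is_derive (fun s => - (k v / 2) * / f s) u
                 (- (k v / 2) * (- Derive f u / f u ^ 2))).
  { apply is_derive_scal, is_derive_inv; [apply f_diff, Hu | exact Hf]. }
  pose proof (is_vderive_plus _ _ _ _ _
    (is_vderive_scal _ _ u _ _ DA
      (is_vderive_surf_u (Derive g) (Derive f) l e u v _ _ (g_diff2 u Hu) (f_diff2 u Hu)))
    (is_vderive_scal _ _ u _ _ Df (is_vderive_const (n v) u))) as H.
  match goal with |- is_vderive _ _ ?d => replace d with
   (plus
     (plus (scal (eps / 2 * Derive A u) (surf (Derive g) (Derive f) l e u v))
        (scal (eps / 2 * A u)
           (plus (scal (Derive (Derive g) u) (l v)) (scal (Derive (Derive f) u) e))))
     (plus (scal (- (k v / 2) * (- Derive f u / f u ^ 2)) (n v))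
        (scal (- (k v / 2) * / f u) zero))); [exact H |] end.
  rewrite (z_u u v Hu), (g''_eq u Hu).
  apply inner_ext; intro w; unfold N, meridian_normal, surf; expand_inner.
  field; auto.
Qed.

(** With [k = 0] only [N] depends on [v], and [N_v = g' l'] is tangent. *)
Lemma nabla_v_eq u v : (forall v, J v -> k v = 0) -> I u -> J v ->
  nabla_perp_v z (mean_curvature z) u v = zero.
Proof.
  intros Hk Hu Hv.
  transitivity (plus (scal 0 (N u v)) (scal 0 (n v))); [| vec_ring].
  apply (normal_part_eq u v _ 0 (eps / 2 * A u * Derive g u)); try assumption.
  apply vDerive_unique.
  apply (is_vderive_ext_loc (fun s => scal (eps / 2 * A u) (N u s))).
  { apply (filter_imp J).
    - intros s Hs; rewrite (mean_curvature_eq u s Hu Hs), (Hk s Hs).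
      apply inner_ext; intro w; expand_inner; field.
      apply (mf_f0 M u Hu).
    - apply open_interval_locally; [apply (mf_J M) | exact Hv]. }
  pose proof (is_vderive_scal (fun _ => eps / 2 * A u) _ v 0 _ (is_derive_const _ _)
    (is_vderive_surf_v (Derive g) (Derive f) l e u v _ (mf_l M v Hv))) as H.
  match goal with |- is_vderive _ _ ?d => replace d with
   (plus (scal 0 (surf (Derive g) (Derive f) l e u v))
         (scal (eps / 2 * A u) (scal (Derive g u) (vDerive l v)))) end; [exact H |].
  unfold t; vec_ring.
Qed.

(** The component of the derivative in [u] along [n] forces [k = 0], and then the
    derivative in [v] is tangent; so [k] is never differentiated. *)
Lemma parallel_iff : (exists u, I u) -> (exists v, J v) ->
  parallel_mean_curvature I J z <->
  (forall v, J v -> k v = 0) /\ (forall u, I u -> Derive A u = 0).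
Proof.
  intros [u0 Hu0] [v0 Hv0]; split.
  - intros H.
    assert (K : forall u v, I u -> J v -> Derive A u = 0 /\ k v = 0).
    { intros u v Hu Hv.
      destruct (H u v Hu Hv) as [Hp _]; rewrite (nabla_u_eq u v Hu Hv) in Hp.
      pose proof (f_equal (fun p => inner p (N u v)) Hp) as HN.
      pose proof (f_equal (fun p => inner p (n v)) Hp) as Hn.
      revert HN Hn; cbv beta; expand_inner.
      rewrite (inner_sym (n v) (N u v)); unfold N, meridian_normal.
      rewrite (surf_ortho_n _ _ u v Hv), (surf_inner _ _ _ _ u v Hv),
        (nn_eps v Hv).
      pose proof (mf_unit M u Hu) as Hunit.
      pose proof (mf_f0 M u Hu) as Hf.
      pose proof (f'_neq0 u Hu) as Hf'.
      pose proof (is_sign_sq eps (mf_eps M)) as Heps.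
      intros HN Hn; split.
      - replace (Derive g u * Derive g u - Derive f u * Derive f u) with (-1) in HN by lra.
        assert (E : eps * eps * Derive A u = 0) by lra.
        rewrite Heps in E; lra.
      - assert (E : k v * Derive f u / (2 * f u ^ 2) * eps = 0) by lra.
        assert (E' : k v * Derive f u = 0).
        { replace (k v * Derive f u) with
            (k v * Derive f u / (2 * f u ^ 2) * eps * (2 * f u ^ 2) * eps)
            by (field [Heps]; exact Hf).
          rewrite E; ring. }
        apply Rmult_integral in E'; tauto. }
    split; [intros v Hv; apply (K u0 v Hu0 Hv) | intros u Hu; apply (K u v0 Hu Hv0)].
  - intros [Hk HA] u v Hu Hv; split; [| apply nabla_v_eq; assumption].
    rewrite (nabla_u_eq u v Hu Hv), (HA u Hu), (Hk v Hv).
    pose proof (mf_f0 M u Hu) as Hf.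
    apply inner_ext; intro w; expand_inner; field; exact Hf.
Qed.

Lemma nonminimal_trace_coef : ~ minimal I J z -> (forall v, J v -> k v = 0) ->
  exists u, I u /\ A u <> 0.
Proof.
  intros Hmin Hk; apply NNPP; intros Hn; apply Hmin; intros u v Hu Hv.
  assert (HA : A u = 0) by (apply NNPP; intros HA; apply Hn; exists u; tauto).
  rewrite (mean_curvature_eq u v Hu Hv), HA, (Hk v Hv).
  pose proof (mf_f0 M u Hu) as Hf.
  apply inner_ext; intro w; expand_inner; field; exact Hf.
Qed.

(** * The meridian equation *)

(** This integrates the meridian equation: when [A] is constant the right-hand side is
    the derivative of [A f^2 / 2]. *)
Lemma fg'_diff u : I u ->
  is_derive (fun s => f s * Derive g s) u (f u * Derive f u * A u).
Proof.
  intros Hu; evar_last.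
  - apply (is_derive_mult f (Derive g)); [apply f_diff, Hu | apply g_diff2, Hu |].
    intros; apply Rmult_comm.
  - unfold plus, mult; cbn; rewrite (g''_eq u Hu); unfold A, trace_coef.
    pose proof (mf_f0 M u Hu); pose proof (mf_g0 M u Hu); field; auto.
Qed.

Lemma quadratic_diff b c u : I u ->
  is_derive (fun s => c + b * f s ^ 2) u (2 * b * f u * Derive f u).
Proof.
  intros Hu; evar_last.
  - apply (is_derive_plus (fun _ => c) (fun s => b * f s ^ 2)); [apply @is_derive_const |].
    apply is_derive_scal, is_derive_pow, f_diff, Hu.
  - unfold plus, zero; cbn; ring.
Qed.

(** The constants are [a = A / 2] and the value [c] of the first integral
    [f g' - a f^2]. *)
Lemma meridian_ode : (exists u, I u /\ A u <> 0) ->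
  (forall u, I u -> Derive A u = 0) ->
  exists s1 s2 a c, is_sign s1 /\ is_sign s2 /\ a <> 0 /\
    forall u, I u -> Derive f u = phi s1 s2 a c (f u).
Proof.
  intros (u0 & Hu0 & HA0) HA.
  set (a := A u0 / 2); set (c := f u0 * Derive g u0 - a * f u0 ^ 2).
  assert (HAc : forall u, I u -> A u = 2 * a).
  { intros u Hu; rewrite (derive_zero_const I A u u0 (mf_I M)); try assumption.
    - unfold a; field.
    - intros s Hs; rewrite <- (HA s Hs); apply trace_coef_diff, Hs. }
  assert (Hint : forall u, I u -> f u * Derive g u = c + a * f u ^ 2).
  { intros u Hu.
    assert (E : f u * Derive g u - (c + a * f u ^ 2)
              = f u0 * Derive g u0 - (c + a * f u0 ^ 2)).
    { apply (derive_zero_const I (fun s => f s * Derive g s - (c + a * f s ^ 2)));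
        try assumption; [apply (mf_I M) |].
      intros s Hs; evar_last.
      - apply (is_derive_minus (fun s => f s * Derive g s) (fun s => c + a * f s ^ 2));
          [apply fg'_diff, Hs | apply quadratic_diff, Hs].
      - rewrite (HAc s Hs); unfold minus, plus, opp; cbn; ring. }
    unfold c in *; lra. }
  (* The sign in front of the square root is that of [f f']. *)
  destruct (nonzero_constant_sign I (fun s => f s * Derive f s) (mf_I M)) as (s1 & Hs1 & Hpos).
  { intros s Hs; apply (ex_derive_mult f (Derive f)); eexists;
      [apply f_diff, Hs | apply f_diff2, Hs]. }
  { intros s Hs; apply Rmult_integral_contrapositive_currified;
      [apply (mf_f0 M s Hs) | apply f'_neq0, Hs]. }
  exists s1, 1, a, c; split; [exact Hs1 |]; split; [left; reflexivity |]; split.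
  - unfold a; lra.
  - intros u Hu; unfold phi.
    rewrite (sqrt_of_sq s1 (f u * Derive f u)); [| exact Hs1 | left; apply Hpos, Hu |].
    + pose proof (is_sign_sq s1 Hs1) as E; pose proof (mf_f0 M u Hu).
      field [E]; assumption.
    + rewrite Rmult_1_l, <- (Hint u Hu), !Rpow_mult_distr.
      pose proof (mf_unit M u Hu) as E.
      replace (Derive f u ^ 2) with (1 + Derive g u ^ 2) by lra; ring.
Qed.

(** The equation determines [f g'] up to sign as a quadratic function of [f]; the
    sign [r] is constant because neither side vanishes. *)
Lemma trace_coef_const_of_ode s1 s2 a c : is_sign s1 ->
  (forall u, I u -> Derive f u = phi s1 s2 a c (f u)) ->
  forall u, I u -> Derive A u = 0.
Proof.
  intros Hs1 Hode.
  set (P := fun s => c + s2 * a * f s ^ 2).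
  assert (Hsq : forall u, I u -> (f u * Derive g u) ^ 2 = P u ^ 2).
  { intros u Hu; pose proof (mf_f0 M u Hu) as Hf.
    assert (E : f u * Derive f u = s1 * sqrt (P u ^ 2 + f u ^ 2)).
    { rewrite (Hode u Hu); unfold phi, P.
      replace (c + s2 * (a * f u ^ 2)) with (c + s2 * a * f u ^ 2) by ring.
      field; exact Hf. }
    apply (f_equal (fun x => x ^ 2)) in E; revert E; cbv beta.
    rewrite !Rpow_mult_distr, pow2_sqrt
      by (pose proof (pow2_ge_0 (P u)); pose proof (pow2_ge_0 (f u)); lra).
    replace (s1 ^ 2) with 1 by (pose proof (is_sign_sq s1 Hs1); lra).
    pose proof (mf_unit M u Hu) as Hunit.
    replace (Derive f u ^ 2) with (1 + Derive g u ^ 2) by lra; intros E; lra. }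
  assert (Hfg : forall u, I u -> f u * Derive g u <> 0).
  { intros u Hu; apply Rmult_integral_contrapositive_currified;
      [apply (mf_f0 M u Hu) | apply (mf_g0 M u Hu)]. }
  destruct (nonzero_constant_sign I (fun s => f s * Derive g s * P s) (mf_I M))
    as (r & Hr & Hpos).
  { intros s Hs; apply (ex_derive_mult (fun s => f s * Derive g s) P); eexists;
      [apply fg'_diff, Hs | apply quadratic_diff, Hs]. }
  { intros s Hs; apply Rmult_integral_contrapositive_currified; [apply Hfg, Hs |].
    intros E; apply (Hfg s Hs); specialize (Hsq s Hs); rewrite E in Hsq; nra. }
  assert (Hlin : forall u, I u -> f u * Derive g u - r * P u = 0).
  { intros u Hu; rewrite (sq_eq_sign r (f u * Derive g u) (P u)); [ring | exact Hr | |].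
    - apply Hsq, Hu.
    - apply Hpos, Hu. }
  assert (HA : forall u, I u -> A u = 2 * r * s2 * a).
  { intros u Hu.
    assert (E : f u * Derive f u * A u - r * (2 * (s2 * a) * f u * Derive f u) = 0).
    { apply (derive_locally_const I (fun s => f s * Derive g s - r * P s) 0 u);
        [apply (mf_I M) | exact Hlin | exact Hu |].
      apply (is_derive_minus (fun s => f s * Derive g s) (fun s => r * P s));
        [apply fg'_diff, Hu | apply is_derive_scal, quadratic_diff, Hu]. }
    apply (Rmult_eq_reg_l (f u * Derive f u)); [lra |].
    apply Rmult_integral_contrapositive_currified;
      [apply (mf_f0 M u Hu) | apply f'_neq0, Hu]. }
  intros u Hu; apply (derive_locally_const I A _ u _ (mf_I M) HA Hu).
  apply trace_coef_diff, Hu.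
Qed.

Lemma meridian_g_determined : g_determined I f g.
Proof.
  destruct (nonzero_constant_sign I (Derive g) (mf_I M)) as (s & Hs & Hpos).
  { intros u Hu; eexists; apply g_diff2, Hu. }
  { apply (mf_g0 M). }
  assert (H : forall u, I u -> sqrt (Derive f u ^ 2 - 1) = s * Derive g u).
  { intros u Hu; apply sqrt_of_sq; [exact Hs | left; apply Hpos, Hu |].
    pose proof (mf_unit M u Hu); lra. }
  destruct Hs as [-> | ->]; [left | right]; intros u Hu; rewrite (H u Hu).
  - ring.
  - rewrite Derive_opp; ring.
Qed.

(** The result for an arbitrary unit-speed curve [l] in place of the parametrized
    one. *)
Theorem parallel_characterization : ~ minimal I J z ->
  (parallel_mean_curvature I J z <->
    (forall v, J v -> k v = 0) /\
    (exists s1 s2 a c, is_sign s1 /\ is_sign s2 /\ a <> 0 /\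
      forall u, I u -> Derive f u = phi s1 s2 a c (f u)) /\
    g_determined I f g) /\
  (parallel_mean_curvature I J z -> lies_in_hyperplane I J z).
Proof.
  intros Hmin.
  assert (Hne : (exists u, I u) /\ (exists v, J v)).
  { split; apply NNPP; intros Hn; apply Hmin; intros u v Hu Hv; exfalso; apply Hn; eauto. }
  destruct Hne as [HI HJ].
  rewrite (parallel_iff HI HJ); split; [split |].
  - intros [Hk HA]; split; [exact Hk |]; split; [| apply meridian_g_determined].
    apply meridian_ode; [apply nonminimal_trace_coef |]; assumption.
  - intros (Hk & (s1 & s2 & a & c & Hs1 & _ & _ & Hode) & _); split; [exact Hk |].
    apply (trace_coef_const_of_ode s1 s2 a c Hs1 Hode).
  - intros [Hk _]; apply lies_in_hyperplane_of_flat; assumption.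
Qed.

End Geometry.

(** * The two types of meridian surfaces *)

(** The geometry above uses two derivatives of [l], and this class is closed under
    the operations that occur in its coordinates. *)
Definition twice_derivable_on (D : R -> Prop) (h : R -> R) : Prop :=
  forall x, D x -> ex_derive h x /\ ex_derive (Derive h) x.

Lemma smooth_twice_derivable (D : R -> Prop) (h : R -> R) :
  smooth_on D h -> twice_derivable_on D h.
Proof. intros H x Hx; split; [apply (H 1%nat x Hx) | apply (H 2%nat x Hx)]. Qed.

Lemma twice_derivable_ext (D : R -> Prop) (h h' : R -> R) :
  (forall x, h' x = h x) -> twice_derivable_on D h -> twice_derivable_on D h'.
Proof.
  intros E H x Hx; destruct (H x Hx) as [H1 H2]; split.
  - apply (ex_derive_ext h); [intros; symmetry; apply E | exact H1].
  - apply (ex_derive_ext (Derive h)); [| exact H2].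
    intros y; apply Derive_ext; intros; symmetry; apply E.
Qed.

Lemma twice_derivable_const (D : R -> Prop) (c : R) : twice_derivable_on D (fun _ => c).
Proof.
  intros x _; split; [apply @ex_derive_const |].
  apply (ex_derive_ext (fun _ => 0)); [| apply @ex_derive_const].
  intros y; symmetry; apply Derive_const.
Qed.

Lemma twice_derivable_mult (D : R -> Prop) (h k : R -> R) : is_open_interval D ->
  twice_derivable_on D h -> twice_derivable_on D k ->
  twice_derivable_on D (fun s => h s * k s).
Proof.
  intros HD Hh Hk x Hx; split.
  - apply (ex_derive_mult h k); [apply (Hh x Hx) | apply (Hk x Hx)].
  - apply (ex_derive_ext_loc (fun s => Derive h s * k s + h s * Derive k s)).
    + apply (filter_imp D); [| apply open_interval_locally; assumption].
      intros s Hs; symmetry; apply Derive_mult; [apply (Hh s Hs) | apply (Hk s Hs)].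
    + apply (ex_derive_plus (fun s => Derive h s * k s) (fun s => h s * Derive k s)).
      * apply (ex_derive_mult (Derive h) k); [apply (Hh x Hx) | apply (Hk x Hx)].
      * apply (ex_derive_mult h (Derive k)); [apply (Hh x Hx) | apply (Hk x Hx)].
Qed.

Lemma twice_derivable_comp (D : R -> Prop) (F F1 F2 w : R -> R) : is_open_interval D ->
  (forall y, is_derive F y (F1 y)) -> (forall y, is_derive F1 y (F2 y)) ->
  twice_derivable_on D w -> twice_derivable_on D (fun s => F (w s)).
Proof.
  intros HD HF HF1 Hw x Hx; split.
  - apply (ex_derive_comp F w); [eexists; apply HF | apply (Hw x Hx)].
  - apply (ex_derive_ext_loc (fun s => Derive w s * F1 (w s))).
    + apply (filter_imp D); [| apply open_interval_locally; assumption].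
      intros s Hs; symmetry; apply is_derive_unique.
      apply (is_derive_comp F w); [apply HF | apply Derive_correct, (Hw s Hs)].
    + apply (ex_derive_mult (Derive w) (fun s => F1 (w s))); [apply (Hw x Hx) |].
      apply (ex_derive_comp F1 w); [eexists; apply HF1 | apply (Hw x Hx)].
Qed.

Lemma is_derive_cosh y : is_derive cosh y (sinh y).
Proof. apply is_derive_Reals, derivable_pt_lim_cosh. Qed.

Lemma is_derive_sinh y : is_derive sinh y (cosh y).
Proof. apply is_derive_Reals, derivable_pt_lim_sinh. Qed.

Definition axis (T : mtype) : vec4 := match T with Mb => e4 | Ma => e1 end.

Lemma meridian_map_surf (T : mtype) (f g w1 w2 : R -> R) :
  meridian_map T f g w1 w2 = surf f g (lcurve T w1 w2) (axis T).
Proof.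
  apply functional_extensionality; intros u; apply functional_extensionality; intros v.
  destruct T; unfold meridian_map, surf, axis; vec_ring.
Qed.

Lemma lcurve_twice_derivable (T : mtype) (J : R -> Prop) (w1 w2 : R -> R) :
  is_open_interval J -> smooth_on J w1 -> smooth_on J w2 ->
  twice_derivable_on J (fun v => x1 (lcurve T w1 w2 v)) /\
  twice_derivable_on J (fun v => x2 (lcurve T w1 w2 v)) /\
  twice_derivable_on J (fun v => x3 (lcurve T w1 w2 v)) /\
  twice_derivable_on J (fun v => x4 (lcurve T w1 w2 v)).
Proof.
  intros HJ H1%smooth_twice_derivable H2%smooth_twice_derivable.
  pose proof (twice_derivable_comp J _ _ _ _ HJ is_derive_cosh is_derive_sinh H1) as Hch.
  pose proof (twice_derivable_comp J _ _ _ _ HJ is_derive_sinh is_derive_cosh H1) as Hsh.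
  assert (Hc : twice_derivable_on J (fun v => cos (w2 v))).
  { apply (twice_derivable_comp J cos (fun y => - sin y) (fun y => - cos y)); try assumption.
    - apply is_derive_cos.
    - intros y; apply (is_derive_opp sin), is_derive_sin. }
  assert (Hs : twice_derivable_on J (fun v => sin (w2 v))).
  { apply (twice_derivable_comp J sin cos (fun y => - sin y)); try assumption.
    - apply is_derive_sin.
    - apply is_derive_cos. }
  pose proof (twice_derivable_mult J _ _ HJ Hch Hc) as Hchc.
  pose proof (twice_derivable_mult J _ _ HJ Hch Hs) as Hchs.
  pose proof (twice_derivable_const J 0) as H0.
  destruct T; (split; [| split; [| split]]);
    [eapply twice_derivable_ext; [| exact Hchc] | eapply twice_derivable_ext; [| exact Hchs]
     | eapply twice_derivable_ext; [| exact Hsh] | eapply twice_derivable_ext; [| exact H0]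
     | eapply twice_derivable_ext; [| exact H0] | eapply twice_derivable_ext; [| exact Hsh]
     | eapply twice_derivable_ext; [| exact Hchc] | eapply twice_derivable_ext; [| exact Hchs]];
    intros v; cbn; unfold plus, scal; cbn; unfold mult; cbn; ring.
Qed.

Lemma lcurve_norm (T : mtype) (w1 w2 : R -> R) (v : R) :
  inner (lcurve T w1 w2 v) (lcurve T w1 w2 v) = - lspeed T.
Proof.
  assert (Hh : cosh (w1 v) * cosh (w1 v) = 1 + sinh (w1 v) * sinh (w1 v)).
  { unfold cosh, sinh.
    assert (E : exp (w1 v) * exp (- w1 v) = 1)
      by (rewrite <- exp_plus, Rplus_opp_r; apply exp_0).
    field [E]. }
  assert (Hc : sin (w2 v) * sin (w2 v) = 1 - cos (w2 v) * cos (w2 v)).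
  { pose proof (sin2_cos2 (w2 v)) as E; unfold Rsqr in E; lra. }
  destruct T; unfold lcurve, inner, lspeed; cbn; unfold plus, scal; cbn; unfold mult; cbn;
    ring [Hh Hc].
Qed.

Lemma axis_norm (T : mtype) : inner (axis T) (axis T) = lspeed T.
Proof. destruct T; unfold inner; cbn; ring. Qed.

Lemma in_lspace_axis (T : mtype) (p : vec4) : in_lspace T p -> inner p (axis T) = 0.
Proof. destruct T; unfold in_lspace, inner; cbn; intros ->; ring. Qed.

Lemma lcurve_in_lspace (T : mtype) (w1 w2 : R -> R) (v : R) : in_lspace T (lcurve T w1 w2 v).
Proof. destruct T; cbn; unfold plus, scal; cbn; unfold mult; cbn; ring. Qed.

Lemma meridian_surface_frame (T : mtype) (I J : R -> Prop) (f g w1 w2 : R -> R)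
    (n : R -> vec4) :
  meridian_surface T I J f g w1 w2 -> (forall u, I u -> Derive g u <> 0) ->
  spherical_normal T J (lcurve T w1 w2) n ->
  meridian_frame I J f g (lcurve T w1 w2) n (axis T) (- lspeed T).
Proof.
  intros [HI HJ Hf Hg H1 H2 Hf0 Hl Hm] Hg0 [(N1 & N2 & N3 & N4) Hn].
  destruct (lcurve_twice_derivable T J w1 w2 HJ H1 H2) as (L1 & L2 & L3 & L4).
  constructor; try assumption.
  - destruct T; [left | right]; cbn; ring.
  - intros v Hv; apply is_vderive_vDerive;
      [apply (L1 v Hv) | apply (L2 v Hv) | apply (L3 v Hv) | apply (L4 v Hv)].
  - intros v Hv; apply is_vderive_vDerive;
      [apply (L1 v Hv) | apply (L2 v Hv) | apply (L3 v Hv) | apply (L4 v Hv)].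
  - intros v Hv; apply is_vderive_vDerive;
      [apply (N1 1%nat v Hv) | apply (N2 1%nat v Hv) | apply (N3 1%nat v Hv)
       | apply (N4 1%nat v Hv)].
  - intros v _; apply lcurve_norm.
  - intros v Hv; rewrite (Hl v Hv); ring.
  - intros v Hv; apply (Hn v Hv).
  - intros v Hv; apply (Hn v Hv).
  - intros v Hv; apply (Hn v Hv).
  - rewrite axis_norm; ring.
  - intros v _; apply in_lspace_axis, lcurve_in_lspace.
  - intros v Hv; apply in_lspace_axis, (Hn v Hv).
Qed.

Theorem theorem4p2 (T : mtype) (I J : R -> Prop) (f g w1 w2 : R -> R)
    (n : R -> vec4)
    (hM : meridian_surface T I J f g w1 w2)
    (hg : forall u : R, I u -> Derive g u <> 0)
    (hn : spherical_normal T J (lcurve T w1 w2) n)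
    (hmin : ~ minimal I J (meridian_map T f g w1 w2)) :
  (parallel_mean_curvature I J (meridian_map T f g w1 w2) <->
    (forall v : R, J v -> spherical_curvature (lcurve T w1 w2) n v = 0) /\
    (exists s1 s2 a c : R, is_sign s1 /\ is_sign s2 /\ a <> 0 /\
      forall u : R, I u -> Derive f u = phi s1 s2 a c (f u)) /\
    g_determined I f g) /\
  (parallel_mean_curvature I J (meridian_map T f g w1 w2) ->
    lies_in_hyperplane I J (meridian_map T f g w1 w2)).
Proof.
  pose proof (meridian_surface_frame T I J f g w1 w2 n hM hg hn) as M.
  rewrite meridian_map_surf in *.
  apply (parallel_characterization M hmin).
Qed.
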